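(* Let $m<0<M$ be real numbers and let $p$ be a positive real number. Then, for every $f\in\mathcal{F}_{m,M}$ we have $$\|J(f)\|_p\leq\frac{1}{(p+1)^{1/p}}\cdot\frac{-mM}{M-m},$$ with equality if and only if $f$ coincides for almost every $x$ in $[0,1]$ with one of the functions $f_0$ or $f_1$ defined by $$f_0(x)=\begin{cases}M&\text{if }x\in\left[0,\frac{-m}{M-m}\right),\\ m&\text{if }x\in\left[\frac{-m}{M-m},1\right],\end{cases}\qquad f_1(x)=\begin{cases}m&\text{if }x\in\left[0,\frac{M}{M-m}\right),\\ M&\text{if }x\in\left[\frac{M}{M-m},1\right].\end{cases}$$
   Context: For real numbers $m<0<M$, $\mathcal{F}_{m,M}$ denotes the set of functions $f\in L^\infty([0,1])$ (essentially bounded measurable real functions on $[0,1]$) such that $m\leq f\leq M$ and $\int_0^1 f(x)\,dx=0$. For $f\in L^\infty([0,1])$, the continuous function $J(f):[0,1]\to\mathbb{R}$ is defined by $J(f)(x)=\int_0^x f(t)\,dt$. For a positive real $p$ (possibly less than $1$) and $g\in L^\infty([0,1])$, $\|g\|_p=\left(\int_0^1|g(x)|^p\,dx\right)^{1/p}$. *)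

(* Defs.v *)
From mathcomp Require Export all_boot all_order all_algebra.
From mathcomp Require Export all_classical all_reals all_analysis.
Export Order.TTheory GRing.Theory Num.Theory.
Export numFieldNormedType.Exports.

Set Implicit Arguments.
Unset Strict Implicit.
Unset Printing Implicit Defensive.

Local Open Scope classical_set_scope.
Local Open Scope ring_scope.

(* A function on [0,1] is a function R -> R whose values outside [0,1] are
   irrelevant, and an element of L^oo([0,1]) is given by a representative.
   Measurability is Lebesgue (not only Borel) measurability: it is that of the
   domain sigma-algebra of [completed_lebesgue_measure]. *)
Notation leb R := (@completed_lebesgue_measure R).

Definition Linfty01 (R : realType) : set (R -> R) :=
  [set f | (f \_ `[0, 1]) \in Lfun (leb R) +oo%E].

(* As in the library, ['N[mu]_p] makes sense for every real [p > 0] (for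
   [p < 1] it is not a norm) and takes its values in the extended reals. *)
Definition norm01 (R : realType) (p : R) (g : R -> R) : \bar R :=
  ('N[leb R]_p%:E[EFin \o (g \_ `[0%R, 1%R])])%E.

Definition J (R : realType) (f : R -> R) (x : R) : R :=
  \int[leb R]_(t in `[0, x]) f t.

Definition FmM (R : realType) (m M : R) : set (R -> R) :=
  [set f | [/\ Linfty01 f,
               {ae leb R, forall x, x \in `[0, 1] -> m <= f x <= M} &
               \int[leb R]_(x in `[0, 1]) f x = 0]].

Definition f0 (R : realType) (m M x : R) : R :=
  if x < - m / (M - m) then M else m.

Definition f1 (R : realType) (m M x : R) : R :=
  if x < M / (M - m) then m else M.

(* Main.v *)
Require Import Defs.
From mathcomp Require Import measurable_realfun ring lra.

Set Implicit Arguments.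
Unset Strict Implicit.
Unset Printing Implicit Defensive.

Local Open Scope classical_set_scope.
Local Open Scope ring_scope.

(** Write F for J(f), so that F(0) = F(1) = 0 and the slopes of F lie in
    [m, M], and put C = -mM/(M-m).  Let h = |F(c)| be the maximum of |F| on
    [0, 1].  Replacing (f, m, M) by (-f, -M, -m), which turns f0 into -f1 and f1
    into -f0, one may assume F(c) = h.

    The function k(u) = h^p - |u|^p is nonnegative on the range of F; let K be
    its primitive vanishing at 0.  Since F climbs from 0 to h on [0, c] with
    slope at most M, and descends from h to 0 on [c, 1] with slope at least m,
    the chain rule gives
      M * int_0^c k(F) >= K(h)   and   -m * int_c^1 k(F) >= K(h).
    Adding these and computing K(h) = p/(p+1) h^(p+1) yields
      int_0^1 |F|^p <= h^p - p/(p+1) h^(p+1)/C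
    ([peak_integral_le]).  Also h <= C, because h <= Mc and h <= -m(1-c), and
    with s = h/C the right-hand side is C^p/(p+1) * s^p (p+1-ps), where
    s^p (p+1-ps) <= 1 with equality only for s = 1 ([powR_tangent_lt]).  This
    is the inequality; sign changes of F are harmless, as K is a primitive of k
    on both sides of 0.

    In the equality case h = C, so that both bounds h <= Mc and h <= -m(1-c)
    are attained: c = -m/(M-m), and f, having the largest possible integral on
    [0, c] and the smallest possible one on [c, 1], is M and then m almost
    everywhere.  Conversely, for f = f0 the slopes are exactly M and m, so all
    the inequalities above are equalities.

    F is only Lipschitz, so the chain rule is replaced by a one-sided estimate
    ([primitive_slope_le]) obtained by summing local increments of K(F) over a
    fine mesh ([nondecreasing_of_local]). *)

(** * Lebesgue integrals over half-open intervals *)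

(** The real line with the Lebesgue-measurable sets, the domain of [leb R]. *)
Notation lebT R :=
  (caratheodory_type (@lebesgue_stieltjes_measure.wlength R idfun)^*%mu).

#[local] Instance ae_leb_filter (R : realType) :
  Filter (nbhs (almost_everywhere (leb R))).
Proof. exact: (@ae_filter_ringOfSetsType _ (lebT R) R (leb R)). Qed.

Section completed_lebesgue.
Context {R : realType}.
Implicit Types (h : R -> R) (a b c : R).

Lemma borel_lebesgue_measurable (A : set R) :
  measurable (A : set (measurableTypeR R)) -> measurable (A : set (lebT R)).
Proof. by move=> mA; apply: sub_caratheodory; exact: mA. Qed.

Lemma lebesgue_measurable_itv (i : interval R) :
  measurable ([set` i] : set (lebT R)).
Proof. by apply: borel_lebesgue_measurable; exact: measurable_itv. Qed.

Lemma continuous_lebesgue_measurable h :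
  continuous h -> measurable_fun (setT : set (lebT R)) h.
Proof.
move=> ch _ Y mY; apply: borel_lebesgue_measurable.
exact: measurable_realfun.continuous_measurable_fun.
Qed.

Lemma leb_itvoc a b : a <= b -> leb R `]a, b] = (b - a)%:E.
Proof.
move=> ab; transitivity (@lebesgue_measure R `]a, b]); first by [].
rewrite lebesgue_measure_itv/= lte_fin -EFinB; case: ltP => // ba.
by congr EFin; apply/esym/eqP; rewrite subr_eq0 eq_le ab ba.
Qed.

Lemma leb_set1 a : leb R [set a] = 0%E.
Proof. exact: (@lebesgue_measure_set1 R a). Qed.

Lemma ae_leb_neq a : {ae leb R, forall x, x != a}.
Proof.
exists [set a]; split.
- by rewrite -set_itv1; exact: lebesgue_measurable_itv.
- exact: leb_set1.
- by move=> x /= /negP; rewrite negbK => /eqP.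
Qed.

Lemma bounded_integrable_itvoc h a b B :
    measurable_fun (setT : set (lebT R)) h ->
    (forall x, a < x <= b -> `|h x| <= B) ->
  (leb R).-integrable `]a, b] (EFin \o h).
Proof.
move=> mh hB; have mab : measurable (`]a, b] : set (lebT R)).
  exact: lebesgue_measurable_itv.
apply: measurable_bounded_integrable => //.
- have [ab|/ltW ba] := leP a b; first by rewrite [ltLHS]leb_itvoc// ltry.
  by rewrite set_itv_ge ?measure0 ?ltry// bnd_simp -leNgt.
- exact: measurable_funTS.
- exists B; split; first exact: num_real.
  by move=> r Br x /=; rewrite in_itv/= => /hB /le_trans; apply; exact: ltW.
Qed.

Lemma Rintegral_itvoc_bounds h a b c d : a <= b ->
    measurable_fun (setT : set (lebT R)) h ->
    (forall x, a < x <= b -> c <= h x <= d) ->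
  c * (b - a) <= \int[leb R]_(x in `]a, b]) h x <= d * (b - a).
Proof.
move=> ab mh hcd.
have ih : (leb R).-integrable `]a, b] (EFin \o h).
  apply: (@bounded_integrable_itvoc _ _ _ (`|c| + `|d|)) => // x.
  move=> /hcd /andP[ch hd].
  rewrite ler_norml; have := ler_norm d; have := ler_norm (- c).
  by rewrite normrN; have := normr_ge0 d; have := normr_ge0 c; lra.
have mab := lebesgue_measurable_itv `]a, b].
have ic e : (leb R).-integrable `]a, b] (EFin \o cst e).
  by apply: (@bounded_integrable_itvoc _ _ _ `|e|).
have Ic e : \int[leb R]_(x in `]a, b]) cst e x = e * (b - a).
  by rewrite Rintegral_cst// [X in fine X]leb_itvoc.
rewrite -(Ic c) -(Ic d); apply/andP; split; apply: le_Rintegral => // x /=;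
  by rewrite in_itv/= => /hcd /andP[].
Qed.

Lemma Rintegral_itvoc_cat h a b c B : a <= b -> b <= c ->
    measurable_fun (setT : set (lebT R)) h ->
    (forall x, a < x <= c -> `|h x| <= B) ->
  \int[leb R]_(x in `]a, c]) h x =
  \int[leb R]_(x in `]a, b]) h x + \int[leb R]_(x in `]b, c]) h x.
Proof.
move=> ab bc mh hB.
have -> : `]a, c]%classic = `]a, b]%classic `|` `]b, c]%classic.
  by rewrite -itv_bndbnd_setU// bnd_simp.
rewrite Rintegral_setU//.
- exact: lebesgue_measurable_itv.
- exact: lebesgue_measurable_itv.
- rewrite -itv_bndbnd_setU// ?bnd_simp//.
  exact: bounded_integrable_itvoc hB.
- rewrite disj_set2E; apply/eqP/seteqP; split => // x /= [].
  by rewrite !in_itv/= => /andP[_ xb] /andP[/lt_le_trans/(_ xb)]; rewrite ltxx.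
Qed.

Lemma Rintegral_itvoc_cstB h a b c B : a <= b ->
    measurable_fun (setT : set (lebT R)) h ->
    (forall x, a < x <= b -> `|h x| <= B) ->
  \int[leb R]_(x in `]a, b]) (c - h x) =
  c * (b - a) - \int[leb R]_(x in `]a, b]) h x.
Proof.
move=> ab mh hB; have mab := lebesgue_measurable_itv `]a, b].
rewrite RintegralB//.
- by congr (_ - _); rewrite Rintegral_cst// [X in fine X]leb_itvoc.
- by apply: (@bounded_integrable_itvoc (cst c) _ _ `|c|).
- exact: bounded_integrable_itvoc hB.
Qed.

End completed_lebesgue.

Section attained_bound.
Context {R : realType}.
Implicit Types (h : R -> R) (a b c B : R).

(** The rigidity behind the equality case: a bound on the integrand that is
    attained on average is attained almost everywhere; here the bound is 0. *)
Lemma Rintegral_itvoc_eq0 h a b B :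
    measurable_fun (setT : set (lebT R)) h ->
    (forall x, a < x <= b -> 0 <= h x <= B) ->
    \int[leb R]_(x in `]a, b]) h x = 0 ->
  {ae leb R, forall x, a < x <= b -> h x = 0}.
Proof.
move=> mh h0 Ih.
have mab := lebesgue_measurable_itv `]a, b].
have ih : (leb R).-integrable `]a, b] (EFin \o h).
  apply: (@bounded_integrable_itvoc _ _ _ _ B) => // x /h0 /andP[hx0 hxB].
  by rewrite ger0_norm.
have E0 : (\int[leb R]_(x in `]a, b]) `|(h x)%:E| = 0)%E.
  transitivity (\int[leb R]_(x in `]a, b]) (h x)%:E)%E.
    apply: eq_integral => x; rewrite inE/= in_itv/= => /h0 /andP[hx0 _].
    by rewrite ger0_norm.
  rewrite -[LHS]fineK; last exact: integrable_fin_num.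
  by congr EFin.
have := (ae_eq_integral_abs (leb R) mab (measurable_int _ ih)).1 E0.
apply: filterS => x /= H xab; have := H; rewrite in_itv/= => /(_ xab) [].
exact.
Qed.

Lemma Rintegral_itvocN h a b B : measurable_fun (setT : set (lebT R)) h ->
    (forall x, a < x <= b -> `|h x| <= B) ->
  \int[leb R]_(x in `]a, b]) (- h x) = - \int[leb R]_(x in `]a, b]) h x.
Proof.
move=> mh hB; rewrite -mulN1r -RintegralZl.
- by apply: eq_Rintegral => t _; rewrite mulN1r.
- exact: lebesgue_measurable_itv.
- exact: bounded_integrable_itvoc mh hB.
Qed.

Lemma ae_eq_upper_bound h a b c B : a <= b ->
    measurable_fun (setT : set (lebT R)) h -> (forall x, `|h x| <= B) ->
    (forall x, a < x <= b -> h x <= c) ->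
    \int[leb R]_(x in `]a, b]) h x = c * (b - a) ->
  {ae leb R, forall x, a < x <= b -> h x = c}.
Proof.
move=> ab mh hB hc Ih.
have mch : measurable_fun (setT : set (lebT R)) (fun x => c - h x).
  exact: measurable_funB.
have : {ae leb R, forall x, a < x <= b -> c - h x = 0}.
  apply: (Rintegral_itvoc_eq0 (B := `|c| + B) mch) => [x /hc hxc|].
    rewrite subr_ge0 hxc/= lerD ?ler_norm//.
    by apply: le_trans (hB x); rewrite -normrN ler_norm.
  by rewrite (Rintegral_itvoc_cstB _ ab mh (fun x _ => hB x)) Ih subrr.
by apply: filterS => x H /H/eqP; rewrite subr_eq0 => /eqP.
Qed.

Lemma ae_eq_lower_bound h a b c B : a <= b ->
    measurable_fun (setT : set (lebT R)) h -> (forall x, `|h x| <= B) ->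
    (forall x, a < x <= b -> c <= h x) ->
    \int[leb R]_(x in `]a, b]) h x = c * (b - a) ->
  {ae leb R, forall x, a < x <= b -> h x = c}.
Proof.
move=> ab mh hB hc Ih.
have mNh : measurable_fun (setT : set (lebT R)) (fun x => - h x).
  exact: measurableT_comp.
have : {ae leb R, forall x, a < x <= b -> - h x = - c}.
  apply: (ae_eq_upper_bound (B := B) ab mNh) => [x|x /hc|].
  - by rewrite normrN.
  - by rewrite lerN2.
  - by rewrite (Rintegral_itvocN mh (fun x _ => hB x)) Ih mulNr.
by apply: filterS => x H /H/eqP; rewrite eqr_opp => /eqP.
Qed.

End attained_bound.

(** * From local increments to global monotonicity *)

Section local_to_global.
Context {R : realType}.
Implicit Types (D q : R -> R) (a b e : R).

(** Heine-Cantor on a segment: by compactness, the moduli of continuity at the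
    points of the segment can be chosen uniformly. *)
Lemma continuous_uniform_itv q a b e : continuous q -> 0 < e ->
  exists2 d, 0 < d & forall x y, x \in `[a, b] -> `|x - y| < d ->
    `|q x - q y| < e.
Proof.
move=> cq e0.
have /compact_near_coveringP/(_ R 0^'+
  (fun d x => forall y, `|x - y| < d -> `|q x - q y| < e)) :=
  @segment_compact R a b.
case=> [x _|r /= r0 Hr].
  have e20 : 0 < e / 2 by rewrite divr_gt0.
  have /cvgrPdist_lt/(_ _ e20)[r /= r0 Hr] := cq x.
  exists (ball x (r / 2), [set d | d < r / 2]).
    split => /=; first by apply: nbhsx_ballx; rewrite divr_gt0.
    by apply: nbhs_right_lt; rewrite divr_gt0.
  move=> [x' d] /= [xx' dr] y x'y.
  have xx'r : `|x - x'| < r / 2 by [].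
  have H1 : `|q x - q x'| < e / 2.
    by apply: Hr => /=; apply: lt_trans xx'r _; lra.
  have H2 : `|q x - q y| < e / 2.
    apply: Hr => /=; rewrite (_ : x - y = (x - x') + (x' - y)); last by ring.
    by apply: (le_lt_trans (ler_normD _ _)); lra.
  rewrite (_ : q x' - q y = - (q x - q x') + (q x - q y)); last by ring.
  by apply: (le_lt_trans (ler_normD _ _)); rewrite normrN; lra.
exists (r / 2) => [|x y xab xy]; first by rewrite divr_gt0.
apply: (Hr (r / 2)) => //=; last by rewrite divr_gt0.
by rewrite sub0r normrN gtr0_norm ?divr_gt0// ltr_pdivrMr// ltr_pMr// ltr1n.
Qed.

(** The loss e * (y - x) on each step of a mesh adds up to e * (b - a) only,
    and e is arbitrary. *)
Lemma nondecreasing_of_local D a b : a <= b ->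
    (forall e, 0 < e -> exists2 d, 0 < d & forall x y,
      a <= x -> x <= y -> y <= b -> y - x < d ->
      - (e * (y - x)) <= D y - D x) ->
  D a <= D b.
Proof.
move=> ab loc; apply/ler_addgt0Pr => e e0.
have [eq_ab|neq_ab] := eqVneq a b; first by rewrite eq_ab lerDl ltW.
have lt_ab : 0 < b - a by rewrite subr_gt0 lt_neqAle neq_ab.
have [d d0 Hd] := loc (e / (b - a)) (divr_gt0 e0 lt_ab).
pose n := (Num.truncn ((b - a) / d)).+1.
have n0 : 0 < n%:R :> R by rewrite ltr0n.
pose s := (b - a) / n%:R.
have s0 : 0 < s by rewrite divr_gt0.
have sd : s < d.
  by rewrite ltr_pdivrMr// mulrC -ltr_pdivrMr// truncnS_gt.
have sn : s * n%:R = b - a by rewrite divfK// gt_eqF.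
have step k : (k <= n)%N -> D a - e / (b - a) * (s * k%:R) <= D (a + s * k%:R).
  elim: k => [_|k IH kn]; first by rewrite !mulr0 addr0 subr0.
  have := Hd (a + s * k%:R) (a + s * k.+1%:R).
  have -> : a + s * k.+1%:R - (a + s * k%:R) = s by rewrite -natr1; ring.
  have k1 : s * k%:R <= s * k.+1%:R by rewrite ler_pM2l// ler_nat.
  have k2 : s * k.+1%:R <= b - a by rewrite -sn ler_pM2l// ler_nat.
  have k3 : 0 <= s * k%:R by rewrite mulr_ge0// ltW.
  move=> /(_ _ _ _ sd) H.
  have {}H : - (e / (b - a) * s) <= D (a + s * k.+1%:R) - D (a + s * k%:R).
    by apply: H; lra.
  have := IH (ltnW kn).
  have -> : e / (b - a) * (s * k.+1%:R) =
    e / (b - a) * (s * k%:R) + e / (b - a) * s by rewrite -natr1; ring.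
  lra.
have := step n (leqnn _); rewrite sn subrKC divfK ?gt_eqF//.
lra.
Qed.

End local_to_global.

(** * A chain rule for Lipschitz functions *)

Lemma continuous_real_comp (R : realType) (f g : R -> R) :
  continuous f -> continuous g -> continuous (fun x => g (f x)).
Proof.
move=> cf cg x; apply: (@continuous_comp R R R f g x); first exact: cf.
exact: (cg (f x)).
Qed.

(** K is a primitive of k, in integrated form: wherever k is within e of w, the
    slopes of K are within e of w.  This form passes from two adjacent intervals
    to their union without differentiating K at their common end. *)
Definition mean_primitive {R : realType} (k K : R -> R) :=
  forall u v w e, u <= v -> (forall s, u <= s <= v -> `|k s - w| <= e) ->
    `|K v - K u - w * (v - u)| <= e * (v - u).

Section chain_rule.
Context {R : realType}.
Implicit Types (F k K : R -> R) (a b L B : R).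

Lemma mean_primitive_between k K u v w e : mean_primitive k K ->
    (forall s, Num.min u v <= s <= Num.max u v -> `|k s - w| <= e) ->
  `|K v - K u - w * (v - u)| <= e * `|v - u|.
Proof.
move=> kK; have [uv|/ltW vu] := leP u v => kw.
  by rewrite [`|v - u|]ger0_norm ?subr_ge0//; exact: kK.
rewrite -normrN [`|v - u|]distrC [`|u - v|]ger0_norm ?subr_ge0//.
have -> : - (K v - K u - w * (v - u)) = K u - K v - w * (u - v) by ring.
exact: kK.
Qed.

Lemma slope_norm_le (m M d s : R) : m < 0 -> 0 < M -> 0 <= d ->
  m * d <= s <= M * d -> `|s| <= (M - m) * d.
Proof.
move=> m0 M0 d0 /andP[ms sM].
have Md : 0 <= M * d by rewrite mulr_ge0// ltW.
have md : 0 <= - m * d by rewrite mulr_ge0// oppr_ge0 ltW.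
by rewrite ler_norml; apply/andP; split; lra.
Qed.

Lemma lipschitz_continuous F B :
  (forall x y, x <= y -> `|F y - F x| <= B * (y - x)) -> continuous F.
Proof.
move=> FB x; have B0 : 0 <= B.
  by have := le_trans (normr_ge0 _) (FB 0 1 ler01); rewrite subr0 mulr1.
have FB' y : `|F x - F y| <= B * `|x - y|.
  have [xy|/ltW yx] := leP x y.
    by rewrite distrC (distrC x) [`|y - x|]ger0_norm ?subr_ge0 ?FB.
  by rewrite [`|x - y|]ger0_norm ?subr_ge0 ?FB.
have B1 : 0 < B + 1 by rewrite ltr_wpDl.
apply/cvgrPdist_lt => e e0.
have := nbhsx_ballx x (e / (B + 1)) (divr_gt0 e0 B1).
apply: filterS => y; rewrite /ball/= ltr_pdivlMr// => xy.
apply: (le_lt_trans (FB' y)); apply: le_lt_trans xy.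
by rewrite mulrC ler_wpM2l// lerDl.
Qed.

(** Formally (K o F)' = k(F) F' <= L k(F), as k(F) >= 0.  For the increments,
    K(F y) - K(F x) is close to k(F x) (F y - F x), hence at most
    k(F x) L (y - x) up to an error, and this is close to the integral of
    L k(F) over ]x, y].  Both errors are small compared with y - x because
    k o F is uniformly continuous. *)
Lemma primitive_slope_le F k K a b L B : a <= b ->
    (forall x y, x <= y -> `|F y - F x| <= B * (y - x)) ->
    (forall x y, a <= x -> x <= y -> y <= b -> F y - F x <= L * (y - x)) ->
    continuous k -> (forall x, a <= x <= b -> 0 <= k (F x)) ->
    mean_primitive k K ->
  K (F b) - K (F a) <= L * \int[leb R]_(x in `]a, b]) k (F x).
Proof.
move=> ab FB FL ck k0 kK.
have cF : continuous F := lipschitz_continuous FB.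
have B0 : 0 <= B.
  by have := le_trans (normr_ge0 _) (FB 0 1 ler01); rewrite subr0 mulr1.
have cq : continuous (k \o F) := continuous_real_comp cF ck.
have mq := continuous_lebesgue_measurable cq.
have [M qM] : exists M, forall x, a < x <= b -> `|k (F x)| <= M.
  have [c _ Hc] := @EVT_max R (k \o F) a b ab (continuous_subspaceT cq).
  exists (k (F c)) => x /andP[ax xb]; rewrite ger0_norm ?k0 ?(ltW ax)//.
  by apply: Hc; rewrite in_itv/= (ltW ax).
pose D x := L * \int[leb R]_(x in `]a, x]) k (F x) - K (F x).
suff : D a <= D b.
  by rewrite /D set_itvoc0 Rintegral_set0 mulr0 sub0r lerBrDr addrC.
apply: nondecreasing_of_local => // e e0.
(* On ]x, y], the error on the integral of k(F) is multiplied by L, and that on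
   K(F y) - K(F x) by B: together they are (B + |L|) * e' * (y - x). *)
have BL : 0 < B + `|L| + 1 by rewrite ltr_wpDl// addr_ge0.
have e'0 : 0 < e / (B + `|L| + 1) by rewrite divr_gt0.
set e' := e / _ in e'0.
have [d d0 Hd] := continuous_uniform_itv a b cq e'0.
exists d => // x y ax xy yb yxd.
have qe t : x <= t <= y -> `|k (F t) - k (F x)| <= e'.
  move=> /andP[xt ty]; rewrite distrC ltW//; apply: (Hd x t).
    by rewrite in_itv/= ax/= (le_trans xy).
  by rewrite ler0_norm; lra.
have -> : D y - D x =
    L * \int[leb R]_(t in `]x, y]) k (F t) - (K (F y) - K (F x)).
  rewrite /D (@Rintegral_itvoc_cat _ (k \o F) a x y M)//; last first.
    by move=> t /andP[ta tb]; apply: qM; rewrite ta (le_trans tb).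
  by rewrite /=; ring.
set I := \int[leb R]_(t in _) _.
have kx0 : 0 <= k (F x) by rewrite k0// ax (le_trans xy).
have : `|L * I - L * (k (F x) * (y - x))| <= `|L| * (e' * (y - x)).
  rewrite -mulrBr normrM ler_wpM2l// ler_distl -mulrBl -mulrDl.
  apply: Rintegral_itvoc_bounds => // t /andP[xt ty].
  by rewrite -ler_distl qe// (ltW xt).
have : `|K (F y) - K (F x) - k (F x) * (F y - F x)| <= e' * (B * (y - x)).
  apply: le_trans (_ : e' * `|F y - F x| <= _); last first.
    by rewrite ler_wpM2l ?FB// ltW.
  apply: mean_primitive_between kK _ => s sF.
  have [t txy <-] := IVT xy (continuous_subspaceT cF) sF.
  by apply: qe; rewrite in_itv in txy.
have : k (F x) * (F y - F x) <= L * (k (F x) * (y - x)).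
  by rewrite mulrCA ler_wpM2l ?FL.
have : `|L| * (e' * (y - x)) + e' * (B * (y - x)) <= e * (y - x).
  rewrite (_ : _ + _ = (e' * (B + `|L|)) * (y - x)); last by ring.
  rewrite ler_wpM2r ?subr_ge0// /e' -mulrA ler_piMr ?ltW//.
  by rewrite mulrC ltr_pdivrMr// mul1r ltrDl.
by rewrite !ler_norml => ? ? /andP[? ?] /andP[? ?]; lra.
Qed.

(** The previous estimate for -F, with the primitive u |-> -K(-u). *)
Lemma primitive_slope_ge F k K a b L B : a <= b ->
    (forall x y, x <= y -> `|F y - F x| <= B * (y - x)) ->
    (forall x y, a <= x -> x <= y -> y <= b -> L * (y - x) <= F y - F x) ->
    continuous k -> (forall x, a <= x <= b -> 0 <= k (F x)) ->
    mean_primitive k K ->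
  L * \int[leb R]_(x in `]a, b]) k (F x) <= K (F b) - K (F a).
Proof.
move=> ab FB FL ck k0 kK.
pose kn u := k (- u).
have -> : L * \int[leb R]_(x in `]a, b]) k (F x) =
    - ((- L) * \int[leb R]_(x in `]a, b]) kn (- F x)).
  rewrite mulNr opprK /kn; congr (_ * _).
  by apply: eq_Rintegral => x _; rewrite opprK.
rewrite lerNl opprB.
pose Kn u := - K (- u).
have -> : K (F a) - K (F b) = Kn (- F b) - Kn (- F a).
  by rewrite /Kn !opprK addrC.
apply: (@primitive_slope_le (fun x => - F x) kn Kn a b (- L) B ab).
- by move=> x y xy; rewrite -opprD normrN FB.
- by move=> x y ax xy yb; rewrite -opprD mulNr lerN2 FL.
- apply: (@continuous_real_comp R (fun u => - u) k) => // u.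
  exact: opp_continuous.
- by move=> x xab; rewrite /kn opprK k0.
- move=> u v w e uv kw; rewrite /Kn.
  have -> : - K (- v) - - K (- u) - w * (v - u) =
      K (- u) - K (- v) - w * (- u - - v) by ring.
  have -> : e * (v - u) = e * (- u - - v) by ring.
  apply: kK; first by rewrite lerN2.
  move=> s /andP[vs su]; have := kw (- s); rewrite /kn opprK; apply.
  by rewrite lerNr su lerNl vs.
Qed.

End chain_rule.

(** * The power function and its primitive *)

Section power_primitive.
Context {R : realType}.
Variable p : R.
Hypothesis p0 : 0 < p.

Lemma continuous_norm_powR : continuous (fun u : R => `|u| `^ p).
Proof.
move=> u; have [->|u0] := eqVneq u 0.
  apply/cvgrPdist_lt => e e0.
  rewrite normr0 powR0 ?gt_eqF//.
  have e'0 : 0 < e `^ p^-1 by rewrite powR_gt0.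
  have := nbhsx_ballx (0 : R) _ e'0.
  apply: filterS => y; rewrite /ball/= !sub0r !normrN => ye.
  rewrite ger0_norm ?powR_ge0//.
  have -> : e = (e `^ p^-1) `^ p by rewrite -powRrM mulVf ?gt_eqF// powRr1 ?ltW.
  by apply: gt0_ltr_powR => //; rewrite nnegrE ?powR_ge0.
apply: (@continuous_comp R R R Num.norm (@powR R ^~ p) u).
  exact: norm_continuous.
apply: differentiable_continuous; apply/derivable1_diffP.
by apply: derivable_powR; rewrite in_itv/= andbT normr_gt0.
Qed.

Let W u := u * `|u| `^ p / (p + 1).

Let p1 : 0 < p + 1. Proof. by rewrite ltr_wpDl ?ltW. Qed.

Let WE u : 0 <= u -> W u = u `^ (p + 1) / (p + 1).
Proof.
by move=> u0; rewrite /W ger0_norm// -[in RHS](mulr_powRB1 u0 p1) addrK.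
Qed.

Let WN u : W (- u) = - W u.
Proof. by rewrite /W normrN !mulNr. Qed.

Lemma powR_mean_value u v : 0 <= u -> u <= v ->
  exists2 s, u <= s <= v & W v - W u = s `^ p * (v - u).
Proof.
move=> u0 uv.
have [||s] :=
  @MVT_segment R (@powR R ^~ (p + 1)) (fun x => (p + 1) * x `^ p) u v uv.
- move=> x; rewrite in_itv/= => /andP[ux _].
  rewrite -[in x `^ p](addrK 1 p).
  by apply: is_derive1_powR; exact: le_lt_trans ux.
- have cW : {within `[u, v], continuous (fun x : R => x * `|x| `^ p)}.
    apply: continuous_subspaceT => x.
    by apply: cvgM; [exact: cvg_id|exact: continuous_norm_powR].
  apply: subspace_eq_continuous cW => x; rewrite inE/= in_itv/= => /andP[ux _].
  have x0 := le_trans u0 ux.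
  by rewrite /from_subspace ger0_norm// -[in RHS](mulr_powRB1 x0 p1) addrK.
rewrite in_itv/= => usv E; exists s => //.
rewrite !WE ?(le_trans u0)// -mulrBl E; field.
by rewrite gt_eqF.
Qed.

(** On the positive half-line this is the mean value theorem, on the negative
    one it follows as the primitive is odd, and the two are glued at 0, where
    |u|^p is not smooth for small p. *)
Lemma mean_primitive_norm_powR :
  mean_primitive (fun u : R => `|u| `^ p) (fun u => u * `|u| `^ p / (p + 1)).
Proof.
rewrite -/W.
have pos u v w e : 0 <= u -> u <= v ->
    (forall s, u <= s <= v -> `| `|s| `^ p - w| <= e) ->
    `|W v - W u - w * (v - u)| <= e * (v - u).
  move=> u0 uv kw; have [s usv ->] := powR_mean_value u0 uv.
  have vu : 0 <= v - u by rewrite subr_ge0.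
  rewrite -mulrBl normrM (ger0_norm vu) ler_wpM2r//.
  have /andP[us _] := usv.
  by have := kw s usv; rewrite (ger0_norm (le_trans u0 us)).
have neg u v w e : v <= 0 -> u <= v ->
    (forall s, u <= s <= v -> `| `|s| `^ p - w| <= e) ->
    `|W v - W u - w * (v - u)| <= e * (v - u).
  move=> v0 uv kw.
  have -> : W v - W u = W (- u) - W (- v) by rewrite !WN opprK addrC.
  have -> : v - u = - u - - v by rewrite opprK addrC.
  apply: pos; rewrite ?oppr_ge0 ?lerN2//.
  move=> s /andP[vs su]; rewrite -(normrN s); apply: kw.
  by rewrite lerNr su lerNl vs.
move=> u v w e uv kw.
have [u0|/ltW u0] := leP 0 u; first exact: pos.
have [v0|/ltW v0] := leP v 0; first exact: neg.
have W0 : W 0 = 0 by rewrite /W !mul0r.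
have := pos 0 v w e (lexx _) v0; have := neg u 0 w e (lexx _) u0.
rewrite W0 !subr0 !sub0r => /(_ _)/[swap]/(_ _).
move=> H1 H2.
have {}H1 : `|W v - w * v| <= e * v.
  apply: H1 => s /andP[s0 sv]; apply: kw.
  by rewrite (le_trans u0 s0).
have {}H2 : `|- W u - w * - u| <= e * - u.
  apply: H2 => s /andP[s0 sv]; apply: kw.
  by rewrite s0 (le_trans sv).
rewrite (_ : W v - W u - _ = (W v - w * v) + (- W u - w * - u)); last by ring.
rewrite (_ : e * (v - u) = e * v + e * - u); last by ring.
exact: le_trans (ler_normD _ _) (lerD H1 H2).
Qed.

End power_primitive.

Lemma mean_primitive_cstB (R : realType) (k K : R -> R) H :
  mean_primitive k K ->
  mean_primitive (fun u => H - k u) (fun u => H * u - K u).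
Proof.
move=> kK u v w e uv kw; rewrite -normrN.
have -> : - (H * v - K v - (H * u - K u) - w * (v - u)) =
    K v - K u - (H - w) * (v - u) by ring.
apply: kK => // s /kw; rewrite -normrN; congr (`|_| <= _); ring.
Qed.

(** Divided by s^p, this is exp(-p ln s) > 1 - p ln s >= 1 + p (1 - s). *)
Lemma powR_tangent_lt (R : realType) (p s : R) : 0 < p -> 0 <= s < 1 ->
  s `^ p * (p + 1 - p * s) < 1.
Proof.
move=> p0 /andP[]; rewrite le_eqVlt => /predU1P[<- _|s0 s1].
  by rewrite powR0 ?gt_eqF// mul0r.
rewrite -ltr_pdivlMl ?powR_gt0// mulr1 -powRN /powR gt_eqF// mulNr -mulrN.
have l0 : ln s < 0 by rewrite ln_lt0// s0.
apply: le_lt_trans (expR_gt1Dx _); last first.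
  by rewrite mulf_neq0// ?(gt_eqF p0)// oppr_eq0 lt_eqF.
have : ln s <= s - 1.
  have := @le_ln1Dx R (s - 1); rewrite subrKC; apply; lra.
rewrite -(ler_pM2l p0); lra.
Qed.

(** * The estimate for functions with bounded slopes *)

Section tent_estimate.
Context {R : realType}.
Variables (m M p : R) (F : R -> R).
Hypotheses (m0 : m < 0) (M0 : 0 < M) (p0 : 0 < p).
Hypothesis slopes :
  forall x y, x <= y -> m * (y - x) <= F y - F x <= M * (y - x).
Hypotheses (F0 : F 0 = 0) (F1 : F 1 = 0).

Let C := - (m * M) / (M - m).
Let I := \int[leb R]_(x in `]0, 1]) `|F x| `^ p.

Let Mm : 0 < M - m. Proof. by rewrite subr_gt0 (lt_trans m0). Qed.
Let CE : C * (M - m) = - (m * M). Proof. by rewrite divfK// gt_eqF. Qed.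
Let C0 : 0 < C. Proof. by rewrite divr_gt0// oppr_gt0 nmulr_rlt0. Qed.

Let lipF x y : x <= y -> `|F y - F x| <= (M - m) * (y - x).
Proof. by move=> xy; apply: slope_norm_le (slopes xy); rewrite ?subr_ge0. Qed.

(** F stays between the lines of slopes m and M through both ends of its graph;
    M x and m (x - 1) cross at height C, m x and M (x - 1) at height -C. *)
Lemma norm_le_tent_height x : 0 <= x <= 1 -> `|F x| <= C.
Proof.
move=> /andP[x0 x1]; have := slopes x0; have := slopes x1.
rewrite F0 F1 !subr0 sub0r => /andP[H1 H2] /andP[H3 H4].
have H (a b : R) : 0 <= a -> 0 <= b -> 0 <= a * b by exact: mulr_ge0.
have m0' : 0 <= - m by rewrite oppr_ge0 ltW.
rewrite ler_norml -(ler_pM2r Mm) mulNr CE -[X in _ && X](ler_pM2r Mm) CE.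
apply/andP; split.
- have := H _ (F x - m * x) (ltW M0); rewrite subr_ge0 => /(_ H3).
  have := H _ (M * (1 - x) - - F x) m0'; rewrite subr_ge0 => /(_ H2).
  lra.
- have := H _ (M * x - F x) m0'; rewrite subr_ge0 => /(_ H4).
  have := H _ (- F x - m * (1 - x)) (ltW M0); rewrite subr_ge0 => /(_ H1).
  lra.
Qed.

Section peak.
Variable c : R.
Hypothesis c01 : 0 <= c <= 1.
Hypothesis peakF : forall x, 0 <= x <= 1 -> `|F x| <= F c.

Let h := F c.
Let k (u : R) := h `^ p - `|u| `^ p.
Let K (u : R) := h `^ p * u - u * `|u| `^ p / (p + 1).

Let h0 : 0 <= h. Proof. exact: le_trans (normr_ge0 _) (peakF c01). Qed.

Let ck : continuous k.
Proof.
by move=> u; apply: cvgB; [exact: cvg_cst|exact: continuous_norm_powR].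
Qed.

Let kF x : 0 <= x <= 1 -> 0 <= k (F x).
Proof.
move=> x01; rewrite subr_ge0 ge0_ler_powR ?(ltW p0)// ?nnegrE//.
exact: peakF.
Qed.

Let kK : mean_primitive k K.
Proof. exact/mean_primitive_cstB/mean_primitive_norm_powR. Qed.

Let K0 : K 0 = 0. Proof. by rewrite /K mulr0 !mul0r subrr. Qed.

Let Kh : K h = p / (p + 1) * (h `^ p * h).
Proof.
rewrite /K ger0_norm//; field.
by rewrite gt_eqF// ltr_wpDl// ltW.
Qed.

Let cF : continuous F. Proof. exact: lipschitz_continuous lipF. Qed.

Let deficit : \int[leb R]_(x in `]0, c]) k (F x) +
  \int[leb R]_(x in `]c, 1]) k (F x) = h `^ p - I.
Proof.
have /andP[c_ge0 c_le1] := c01.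
have cW : continuous (fun x => `|F x| `^ p).
  exact: (continuous_real_comp cF (continuous_norm_powR p0)).
have ckF : continuous (fun x => k (F x)).
  exact: (continuous_real_comp cF ck).
have bW x : 0 < x <= 1 -> `| `|F x| `^ p | <= h `^ p.
  move=> /andP[x0 x1]; rewrite ger0_norm ?powR_ge0//.
  rewrite ge0_ler_powR ?(ltW p0)// ?nnegrE//.
  by apply: peakF; rewrite (ltW x0).
have mk : measurable_fun (setT : set (lebT R)) (fun x => k (F x)).
  exact: continuous_lebesgue_measurable.
have bk x : 0 < x <= 1 -> `|k (F x)| <= h `^ p.
  move=> /andP[x0 x1]; have x01 : 0 <= x <= 1 by rewrite (ltW x0).
  by rewrite ger0_norm ?kF// /k lerBlDr lerDl powR_ge0.
rewrite -(Rintegral_itvoc_cat c_ge0 c_le1 mk bk).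
have mW := continuous_lebesgue_measurable cW.
by rewrite (Rintegral_itvoc_cstB _ ler01 mW bW) subr0 mulr1.
Qed.

(** The chain rule is used once on the ascent [0, c] and once on the descent
    [c, 1].  As 1/C = 1/M - 1/m, this is the bound
    I <= h^p - p/(p+1) h^(p+1)/C cleared of denominators. *)
Lemma peak_integral_le :
  p / (p + 1) * (h `^ p * h) * (M - m) <= - (m * M) * (h `^ p - I).
Proof.
have /andP[c_ge0 c_le1] := c01.
have H1 : K (F c) - K (F 0) <= M * \int[leb R]_(x in `]0, c]) k (F x).
  apply: (primitive_slope_le c_ge0 lipF _ ck _ kK).
    by move=> x y _ xy _; have /andP[] := slopes xy.
  by move=> x /andP[x0 xc]; rewrite kF// x0 (le_trans xc).
have H2 : m * \int[leb R]_(x in `]c, 1]) k (F x) <= K (F 1) - K (F c).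
  apply: (primitive_slope_ge c_le1 lipF _ ck _ kK).
    by move=> x y _ xy _; have /andP[] := slopes xy.
  by move=> x /andP[xc x1]; rewrite kF// x1 (le_trans c_ge0).
move: H1 H2 deficit; rewrite F0 F1 K0 Kh subr0 sub0r.
set I1 := \int[leb R]_(x in `]0, c]) _; set I2 := \int[leb R]_(x in `]c, 1]) _.
move=> H1 H2 <-.
have : 0 <= (- m) * (M * I1 - p / (p + 1) * (h `^ p * h)).
  by rewrite mulr_ge0 ?subr_ge0// oppr_ge0 ltW.
have : 0 <= M * (- (p / (p + 1) * (h `^ p * h)) - m * I2).
  by rewrite mulr_ge0 ?subr_ge0// ltW.
clear H1 H2; move: I1 I2 (p / (p + 1) * _) => I1 I2 X ? ?; lra.
Qed.

(** When F climbs with slope M and descends with slope m, the two uses of the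
    chain rule can be reversed. *)
Lemma peak_integral_ge :
    (forall x y, 0 <= x -> x <= y -> y <= c -> M * (y - x) <= F y - F x) ->
    (forall x y, c <= x -> x <= y -> y <= 1 -> F y - F x <= m * (y - x)) ->
  - (m * M) * (h `^ p - I) <= p / (p + 1) * (h `^ p * h) * (M - m).
Proof.
move=> slopeM slopem; have /andP[c_ge0 c_le1] := c01.
have H1 : M * \int[leb R]_(x in `]0, c]) k (F x) <= K (F c) - K (F 0).
  apply: (primitive_slope_ge c_ge0 lipF slopeM ck _ kK).
  by move=> x /andP[x0 xc]; rewrite kF// x0 (le_trans xc).
have H2 : K (F 1) - K (F c) <= m * \int[leb R]_(x in `]c, 1]) k (F x).
  apply: (primitive_slope_le c_le1 lipF slopem ck _ kK).
  by move=> x /andP[xc x1]; rewrite kF// x1 (le_trans c_ge0).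
move: H1 H2 deficit; rewrite F0 F1 K0 Kh subr0 sub0r.
set I1 := \int[leb R]_(x in `]0, c]) _; set I2 := \int[leb R]_(x in `]c, 1]) _.
move=> H1 H2 <-.
have : 0 <= (- m) * (p / (p + 1) * (h `^ p * h) - M * I1).
  by rewrite mulr_ge0 ?subr_ge0// oppr_ge0 ltW.
have : 0 <= M * (m * I2 - - (p / (p + 1) * (h `^ p * h))).
  by rewrite mulr_ge0 ?subr_ge0// ltW.
clear H1 H2; move: I1 I2 (p / (p + 1) * _) => I1 I2 X ? ?; lra.
Qed.

Let peak_le : h <= C.
Proof. exact: le_trans (ler_norm _) (norm_le_tent_height c01). Qed.

(** A peak of height C needs at least the length C/M for the ascent and -C/m for
    the descent, and these add up to 1. *)
Lemma peak_abscissa : F c = C -> c = - m / (M - m).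
Proof.
rewrite -/h => hC; have /andP[c_ge0 c_le1] := c01.
have /andP[_] := slopes c_ge0; have /andP[+ _] := slopes c_le1.
rewrite F0 F1 !subr0 sub0r -/h hC => H1 H2.
apply/eqP; rewrite eq_le ler_pdivlMr// ler_pdivrMr//; apply/andP; split.
- have : 0 <= (M - m) * (- C - m * (1 - c)).
    by rewrite mulr_ge0 ?(ltW Mm)// subr_ge0.
  have -> : (M - m) * (- C - m * (1 - c)) =
      - (C * (M - m)) - (M - m) * m * (1 - c) by ring.
  rewrite CE => H; rewrite -(ler_pM2l (_ : 0 < - m)) ?oppr_gt0//; lra.
- have : 0 <= (M - m) * (M * c - C) by rewrite mulr_ge0 ?(ltW Mm)// subr_ge0.
  have -> : (M - m) * (M * c - C) = (M - m) * M * c - C * (M - m) by ring.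
  rewrite CE => H; rewrite -(ler_pM2l M0); lra.
Qed.

(** The bound at the peak height h is C^p/(p+1) times a function of s = h/C that
    is smaller than 1 for s < 1. *)
Lemma integral_norm_powR_le :
  I <= C `^ p / (p + 1) /\ (I = C `^ p / (p + 1) -> F c = C).
Proof.
have p1 : 0 < p + 1 by rewrite ltr_wpDl// ltW.
pose s := h / C.
have hs : h = C * s by rewrite mulrCA divff ?mulr1// gt_eqF.
have s0 : 0 <= s by rewrite divr_ge0// ltW.
have hps : h `^ p = C `^ p * s `^ p by rewrite hs powRM// ltW.
have Cp : 0 < C `^ p by rewrite powR_gt0.
have Ile : I <= C `^ p / (p + 1) * (s `^ p * (p + 1 - p * s)).
  have := peak_integral_le; rewrite -CE (mulrAC C) ler_pM2r//.
  have -> : p / (p + 1) * (h `^ p * h) = C * (p / (p + 1) * (h `^ p * s)).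
    by rewrite {2}hs; ring.
  rewrite ler_pM2l// lerBrDl -lerBrDr => /le_trans; apply.
  rewrite hps le_eqVlt; apply/orP; left; apply/eqP; field.
  by rewrite gt_eqF.
have Cp1 : 0 < C `^ p / (p + 1) by rewrite divr_gt0.
have [hC|neq] := eqVneq h C.
  split=> //; apply: le_trans Ile _.
  by rewrite /s hC divff ?gt_eqF// powR1 mul1r mulr1 addrAC subrr add0r mulr1.
have s1 : s < 1 by rewrite ltr_pdivrMr// mul1r lt_neqAle neq peak_le.
have Ilt : I < C `^ p / (p + 1).
  apply: le_lt_trans Ile _; rewrite gtr_pMr//.
  by apply: powR_tangent_lt => //; rewrite s0.
by split; [exact: ltW|move=> IE; rewrite IE ltxx in Ilt].
Qed.

End peak.

(** At h = C the bounds for the two directions of the chain rule meet. *)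
Lemma integral_norm_powR_tent (c := - m / (M - m)) :
    (forall x y, 0 <= x -> x <= y -> y <= c -> M * (y - x) <= F y - F x) ->
    (forall x y, c <= x -> x <= y -> y <= 1 -> F y - F x <= m * (y - x)) ->
  I = C `^ p / (p + 1).
Proof.
move=> slopeM slopem.
have cM : c * (M - m) = - m by rewrite divfK// gt_eqF.
have c0 : 0 <= c by rewrite divr_ge0 ?(ltW Mm)// oppr_ge0 ltW.
have c1 : c <= 1 by rewrite ler_pdivrMr// mul1r lerDr ltW.
have c01 : 0 <= c <= 1 by rewrite c0 c1.
have FcC : F c = C.
  apply/eqP; rewrite eq_le; apply/andP; split.
    by have := norm_le_tent_height c01; apply: le_trans; exact: ler_norm.
  have := slopeM 0 c (lexx _) c0 (lexx _); rewrite F0 !subr0.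
  by apply: le_trans; rewrite -(ler_pM2r Mm) CE -mulrA cM mulrN mulrC.
have peakF x : 0 <= x <= 1 -> `|F x| <= F c.
  by rewrite FcC; exact: norm_le_tent_height.
have := peak_integral_le c01 peakF.
have := peak_integral_ge c01 peakF slopeM slopem.
rewrite FcC -CE => H1 H2.
have /eqP : p / (p + 1) * (C `^ p * C) * (M - m) = C * (M - m) * (C `^ p - I).
  by apply/eqP; rewrite eq_le H1 H2.
rewrite mulrAC -subr_eq0.
have -> : p / (p + 1) * (M - m) * (C `^ p * C) - C * (M - m) * (C `^ p - I) =
    C * (M - m) * (I - C `^ p / (p + 1)).
  by field; rewrite gt_eqF// ltr_wpDl// ltW.
by rewrite mulf_eq0 (gt_eqF (mulr_gt0 C0 Mm))/= subr_eq0 => /eqP.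
Qed.

End tent_estimate.

(** * Primitives of bounded densities *)

Section primitive.
Context {R : realType}.
Implicit Types g : R -> R.

(** The half-open interval makes [prim g] vanish on the negative half-line, so
    that it is Lipschitz on the whole line. *)
Definition prim g x := \int[leb R]_(t in `]0, x]) g t.

Lemma prim0 g : prim g 0 = 0.
Proof. by rewrite /prim set_itvoc0 Rintegral_set0. Qed.

Section bounded_density.
Variables (m M p : R) (g : R -> R).
Hypotheses (m0 : m < 0) (M0 : 0 < M) (p0 : 0 < p).
Hypothesis mg : measurable_fun (setT : set (lebT R)) g.
Hypothesis gmM : forall x, m <= g x <= M.

Let gB x : `|g x| <= M - m.
Proof. by rewrite -[leRHS]mulr1; apply: slope_norm_le; rewrite ?mulr1. Qed.

Lemma primB x y : 0 <= x -> x <= y ->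
  prim g y - prim g x = \int[leb R]_(t in `]x, y]) g t.
Proof.
move=> x0 xy; rewrite /prim.
rewrite (@Rintegral_itvoc_cat _ g 0 x y (M - m))//.
by rewrite addrAC subrr add0r.
Qed.

(** On the negative half-line the slope is 0, which lies between m and M. *)
Lemma prim_slopes x y : x <= y ->
  m * (y - x) <= prim g y - prim g x <= M * (y - x).
Proof.
have nneg u v : 0 <= u -> u <= v ->
    m * (v - u) <= prim g v - prim g u <= M * (v - u).
  by move=> u0 uv; rewrite primB//; apply: Rintegral_itvoc_bounds.
have neg u : u <= 0 -> prim g u = 0.
  move=> u0; rewrite /prim set_itv_ge ?Rintegral_set0//.
  by rewrite bnd_simp -leNgt.
move=> xy; have [x0|/ltW x0] := leP 0 x; first exact: nneg.
rewrite (neg x)// subr0; have [y0|/ltW y0] := leP 0 y.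
  have := nneg 0 y (lexx _) y0; rewrite prim0 !subr0 => /andP[H1 H2].
  apply/andP; split.
  - by apply: le_trans H1; rewrite ler_nM2l// lerDl oppr_ge0.
  - by apply: (le_trans H2); rewrite ler_pM2l// lerDl oppr_ge0.
by rewrite neg// nmulr_rle0// subr_ge0 xy/= mulr_ge0 ?subr_ge0// ltW.
Qed.

Let C := - (m * M) / (M - m).

Hypothesis g1 : prim g 1 = 0.

(** Equality forces a peak of height C = M c = -m (1 - c), so that the mean of g
    is its upper bound M on ]0, c] and its lower bound m on ]c, 1]. *)
Lemma extremal_of_peak c : 0 <= c <= 1 ->
    (forall x, 0 <= x <= 1 -> `|prim g x| <= prim g c) ->
    \int[leb R]_(x in `]0, 1]) `|prim g x| `^ p = C `^ p / (p + 1) ->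
  {ae leb R, forall x, 0 <= x <= 1 -> g x = f0 m M x}.
Proof.
move=> c01 peak.
have [_ /[apply] FC] :=
  integral_norm_powR_le m0 M0 p0 prim_slopes (prim0 g) g1 c01 peak.
have cE := peak_abscissa m0 M0 prim_slopes (prim0 g) g1 c01 FC.
have Mm : 0 < M - m by rewrite subr_gt0 (lt_trans m0).
have cM : c * (M - m) = - m by rewrite cE divfK// gt_eqF.
have CM : C = M * c by rewrite /C cE mulrA mulrN (mulrC M).
have Cm : C = - m * (1 - c).
  rewrite CM; apply/eqP; rewrite -subr_eq0; apply/eqP.
  by transitivity (c * (M - m) + m); [ring|rewrite cM addNr].
have /andP[c0 c1] := c01.
have L : {ae leb R, forall x, 0 < x <= c -> g x = M}.
  apply: (ae_eq_upper_bound c0 mg gB) => [x _|]; first by have /andP[] := gmM x.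
  by rewrite -primB// prim0 !subr0 FC -/C CM.
have U : {ae leb R, forall x, c < x <= 1 -> g x = m}.
  apply: (ae_eq_lower_bound c1 mg gB) => [x _|]; first by have /andP[] := gmM x.
  by rewrite -primB// g1 FC -/C Cm sub0r mulNr opprK.
have LU : {ae leb R, forall x,
    (0 < x <= c -> g x = M) /\ (c < x <= 1 -> g x = m)}.
  by apply: filterS2 L U.
apply: filterS3 (ae_leb_neq 0) (ae_leb_neq c) LU.
move=> x x0 xc [gM gm] /andP[x_ge0 x_le1].
rewrite /f0 -cE; case: ltP => [xc_lt|xc_ge].
- by apply: gM; rewrite lt_neqAle eq_sym x0 x_ge0 ltW.
- by apply: gm; rewrite lt_neqAle eq_sym xc xc_ge.
Qed.

Lemma value_of_extremal : {ae leb R, forall x, 0 <= x <= 1 -> g x = f0 m M x} ->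
  \int[leb R]_(x in `]0, 1]) `|prim g x| `^ p = C `^ p / (p + 1).
Proof.
move=> gf.
have Mm : 0 < M - m by rewrite subr_gt0 (lt_trans m0).
set c := - m / (M - m) in gf.
have c0 : 0 <= c by rewrite divr_ge0 ?(ltW Mm)// oppr_ge0 ltW.
have c1 : c <= 1 by rewrite ler_pdivrMr// mul1r lerDr ltW.
have gcst d x y : 0 <= x -> x <= y -> y <= 1 ->
    {ae leb R, forall t, x < t <= y -> g t = d} ->
    prim g y - prim g x = d * (y - x).
  move=> x0 xy y1 gd; rewrite primB//.
  have mxy := lebesgue_measurable_itv `]x, y].
  transitivity (\int[leb R]_(t in `]x, y]) d); last first.
    by rewrite Rintegral_cst// [X in fine X]leb_itvoc.
  congr fine; apply: ae_eq_integral.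
  - exact: mxy.
  - by apply/measurable_EFinP; exact: measurable_funTS.
  - exact: measurable_cst.
  - by apply: filterS gd => t /= H; rewrite in_itv/= => /H ->.
apply: (integral_norm_powR_tent m0 M0 p0 prim_slopes (prim0 g) g1).
- move=> x y x0 xy yc; rewrite (gcst M)// ?(le_trans yc)//.
  have := ae_leb_neq c; apply: filterS2 gf => t gt tc /andP[xt ty].
  rewrite gt ?(ltW (le_lt_trans x0 xt)) ?(le_trans ty) ?(le_trans yc)//.
  by rewrite /f0 lt_neqAle tc (le_trans ty).
- move=> x y cx xy y1; rewrite (gcst m)// ?(le_trans c0)//.
  apply: filterS gf => t gt /andP[xt ty].
  have t_ge0 : 0 <= t by rewrite (le_trans c0)// (le_trans cx)// ltW.
  rewrite gt; last by rewrite t_ge0 (le_trans ty).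
  by rewrite /f0 ltNge (le_trans cx) ?ltW.
Qed.

End bounded_density.
End primitive.

(** * The extremal problem for bounded densities *)

Section extremal_problem.
Context {R : realType}.

Lemma continuous_prim (m M : R) (g : R -> R) : m < 0 -> 0 < M ->
    measurable_fun (setT : set (lebT R)) g -> (forall x, m <= g x <= M) ->
  continuous (prim g).
Proof.
move=> m0 M0 mg gmM; apply: (@lipschitz_continuous _ _ (M - m)) => x y xy.
by apply: slope_norm_le (prim_slopes m0 M0 mg gmM xy); rewrite ?subr_ge0.
Qed.

Lemma f0N (m M x : R) : f0 (- M) (- m) x = - f1 m M x.
Proof.
rewrite /f0 /f1 !opprK (addrC (- m)).
by case: ifP.
Qed.

Lemma integral_primN (g : R -> R) B p :
    measurable_fun (setT : set (lebT R)) g -> (forall x, `|g x| <= B) ->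
  \int[leb R]_(x in `]0, 1]) `|prim (\- g) x| `^ p =
  \int[leb R]_(x in `]0, 1]) `|prim g x| `^ p.
Proof.
move=> mg gB; apply: eq_Rintegral => x _; rewrite -[in RHS]normrN.
by rewrite /prim (Rintegral_itvocN mg (fun x _ => gB x)).
Qed.

(** When |prim g| peaks at a negative value of [prim g], the estimate is applied
    to -g, whose values lie between -M and -m. *)
Lemma bounded_density_extremal (m M p : R) (g : R -> R) :
    m < 0 -> 0 < M -> 0 < p ->
    measurable_fun (setT : set (lebT R)) g -> (forall x, m <= g x <= M) ->
    prim g 1 = 0 ->
  let I := \int[leb R]_(x in `]0, 1]) `|prim g x| `^ p in
  let V := (- (m * M) / (M - m)) `^ p / (p + 1) in
  I <= V /\ (I = V <->
    {ae leb R, forall x, 0 <= x <= 1 -> g x = f0 m M x} \/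
    {ae leb R, forall x, 0 <= x <= 1 -> g x = f1 m M x}).
Proof.
move=> m0 M0 p0 mg gmM g1 I V.
have gB x : `|g x| <= M - m.
  by rewrite -[leRHS]mulr1; apply: slope_norm_le; rewrite ?mulr1.
have mNg : measurable_fun (setT : set (lebT R)) (\- g).
  exact: measurableT_comp.
have NgmM x : - M <= (\- g) x <= - m by rewrite !lerN2 andbC; exact: gmM.
have M0' : - M < 0 by rewrite oppr_lt0.
have m0' : 0 < - m by rewrite oppr_gt0.
have Ng1 : prim (\- g) 1 = 0.
  rewrite /prim (Rintegral_itvocN mg (fun x _ => gB x)) -/(prim g 1).
  by rewrite g1 oppr0.
have NV : (- (- M * - m) / (- m - - M)) `^ p / (p + 1) = V.
  by rewrite /V mulrNN (mulrC M) (_ : - m - - M = M - m)//; ring.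
have NI : \int[leb R]_(x in `]0, 1]) `|prim (\- g) x| `^ p = I.
  exact: integral_primN.
have [c c01 peak] : exists2 c, 0 <= c <= 1 &
    forall x, 0 <= x <= 1 -> `|prim g x| <= `|prim g c|.
  have cG : continuous (fun x => `|prim g x|).
    apply: (@continuous_real_comp _ _ Num.norm (continuous_prim m0 M0 mg gmM)).
    exact: norm_continuous.
  have [c + peak] := @EVT_max R _ 0 1 ler01 (continuous_subspaceT cG).
  rewrite in_itv/= => c01; exists c => // x x01; exact: peak.
have [IV extr] : I <= V /\ (I = V ->
    {ae leb R, forall x, 0 <= x <= 1 -> g x = f0 m M x} \/
    {ae leb R, forall x, 0 <= x <= 1 -> g x = f1 m M x}).
  have [Gc|Gc] := leP 0 (prim g c).
    have peak' x : 0 <= x <= 1 -> `|prim g x| <= prim g c.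
      by move=> /peak; rewrite (ger0_norm Gc).
    have slopes := prim_slopes m0 M0 mg gmM.
    have [IV _] := integral_norm_powR_le m0 M0 p0 slopes (prim0 g) g1 c01 peak'.
    split; first exact: IV.
    by move=> E; left; exact: extremal_of_peak peak' E.
  have peak' x : 0 <= x <= 1 -> `|prim (\- g) x| <= prim (\- g) c.
    rewrite /prim !(Rintegral_itvocN mg (fun x _ => gB x)) -!/(prim _ _) normrN.
    by move=> /peak; rewrite (ltr0_norm Gc).
  have slopes := prim_slopes M0' m0' mNg NgmM.
  have [] := integral_norm_powR_le M0' m0' p0 slopes (prim0 _) Ng1 c01 peak'.
  rewrite NV NI => IV _; split; first exact: IV.
  move=> E; right.
  have := extremal_of_peak M0' m0' p0 mNg NgmM Ng1 c01 peak'.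
  rewrite NV NI => /(_ E); apply: filterS => x /= gx /gx.
  by rewrite f0N => /oppr_inj.
split; first exact: IV.
split; [exact: extr|case=> gf].
- exact: value_of_extremal.
- have := value_of_extremal M0' m0' p0 mNg NgmM Ng1; rewrite NV NI; apply.
  by apply: filterS gf => x /= gx /gx; rewrite f0N => ->.
Qed.

End extremal_problem.

(** * Reduction to bounded densities *)

Section reduction.
Context {R : realType}.

(** G(0) = 0 makes [0, 1] and ]0, 1] interchangeable. *)
Lemma norm01_powR (p : R) (G : R -> R) : 0 < p -> continuous G -> G 0 = 0 ->
  norm01 p G =
  ((\int[leb R]_(x in `]0, 1]) `|G x| `^ p) `^ (1 / p))%:E.
Proof.
move=> p0 cG G0; rewrite /norm01 unlock /Lnorm div1r -poweR_EFin.
congr (_ `^ _)%E.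
have mG : measurable_fun (setT : set (lebT R)) (fun x => `|G x| `^ p).
  apply: continuous_lebesgue_measurable.
  exact: (continuous_real_comp cG (continuous_norm_powR p0)).
have [c _ Gc] := @EVT_max R _ 0 1 ler01
  (continuous_subspaceT (continuous_real_comp cG (continuous_norm_powR p0))).
have iG : (leb R).-integrable `]0, 1] (EFin \o (fun x => `|G x| `^ p)).
  apply: (bounded_integrable_itvoc mG) => x /andP[x0 x1].
  by rewrite ger0_norm ?powR_ge0//; apply: Gc; rewrite in_itv/= (ltW x0).
rewrite /Rintegral fineK; last first.
  by apply: integrable_fin_num => //; exact: lebesgue_measurable_itv.
rewrite [RHS]integral_mkcond; apply: eq_integral => x _.
rewrite /patch/= !mem_setE !in_itv/=.
have [x0|x0|<-] := ltgtP 0 x => /=.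
- by case: ifP => _ //=; rewrite normr0 powR0 ?gt_eqF.
- by rewrite normr0 powR0 ?gt_eqF.
- by rewrite ler01 G0 normr0 powR0 ?gt_eqF.
Qed.

Lemma extremal_value_powR (p C : R) : 0 < p -> 0 < C ->
  C `^ p / (p + 1) = (1 / (p + 1) `^ (1 / p) * C) `^ p.
Proof.
move=> p0 C0; have p1 : 0 < p + 1 by rewrite ltr_wpDl// ltW.
rewrite !div1r powRM ?invr_ge0 ?powR_ge0 ?(ltW C0)// mulrC; congr (_ * _).
by rewrite -powRN -powRrM mulNr mulVf ?gt_eqF// powR_inv1// ltW.
Qed.

(** The bounds on f hold only almost everywhere in [0, 1]; extending f by 0 and
    truncating it at m and M makes them hold everywhere, and J(f) is unchanged
    on [0, 1]. *)
Lemma bounded_representative (m M : R) (f : R -> R) :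
    m < 0 -> 0 < M -> FmM m M f ->
  exists g, [/\ measurable_fun (setT : set (lebT R)) g,
    forall x, m <= g x <= M,
    {ae leb R, forall x, 0 <= x <= 1 -> f x = g x} &
    forall x, 0 <= x <= 1 -> J f x = prim g x].
Proof.
move=> m0 M0 [Lf fmM _].
pose f' := f \_ `[0, 1].
have mf : measurable_fun (setT : set (lebT R)) f'.
  by have := sub_Lfun_mfun Lf; rewrite inE.
pose g x := Num.max m (Num.min M (f' x)).
have mg : measurable_fun (setT : set (lebT R)) g.
  apply: measurable_maxr; first exact: measurable_cst.
  by apply: measurable_minr; first exact: measurable_cst.
have fg : {ae leb R, forall x, 0 <= x <= 1 -> f x = g x}.
  apply: filterS fmM => x /= fx x01.
  have x01' : x \in `[0, 1] by rewrite in_itv.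
  rewrite /g /f' patchE mem_setE x01'.
  by have /andP[fm fM] := fx x01'; rewrite (min_idPr fM) (max_idPr fm).
exists g; split => // [x|x /andP[x0 x1]].
  rewrite /g le_max lexx/= ge_max ge_min lexx/= andbT.
  exact: ltW (lt_trans m0 M0).
rewrite /J /prim Rintegral_mkcond [RHS]Rintegral_mkcond; congr fine.
apply: ae_eq_integral.
- exact: measurableT.
- apply/measurable_EFinP.
  rewrite (_ : f \_ `[0, x] = f' \_ `[0, x]); last first.
    apply/funext => t; rewrite /f' !patchE !mem_setE !in_itv/=.
    case: ifP => // /andP[t0 tx]; by rewrite t0 (le_trans tx).
  apply/(measurable_restrictT _ _).1; first exact: lebesgue_measurable_itv.
  exact: measurable_funTS.
- apply/measurable_EFinP.
  apply/(measurable_restrictT _ _).1; first exact: lebesgue_measurable_itv.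
  exact: measurable_funTS.
- apply: filterS2 (ae_leb_neq (0 : R)) fg => t tn0 ft _ /=.
  rewrite !patchE !mem_setE !in_itv/= [0 < t]lt_neqAle eq_sym tn0/=.
  by case: ifP => // /andP[t0 tx]; rewrite ft// t0 (le_trans tx).
Qed.

End reduction.

Theorem corollary2p4 (R : realType) (m M p : R)
    (hm : m < 0) (hM : 0 < M) (hp : 0 < p) (f : R -> R) (hf : FmM m M f) :
  (norm01 p (J f) <=
     (1 / (p + 1) `^ (1 / p) * (- (m * M) / (M - m)))%:E)%E /\
  (norm01 p (J f) = (1 / (p + 1) `^ (1 / p) * (- (m * M) / (M - m)))%:E <->
     (f = f0 m M %[ae leb R in `[0, 1]%classic]) \/
     (f = f1 m M %[ae leb R in `[0, 1]%classic])).
Proof.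
have [g [mg gmM fg Jfg]] := bounded_representative hm hM hf.
have g1 : prim g 1 = 0.
  by rewrite -Jfg ?ler01 ?lexx//; case: hf.
have ae_fg (e : R -> R) : (f = e %[ae leb R in `[0, 1]%classic]) <->
    {ae leb R, forall x, 0 <= x <= 1 -> g x = e x}.
  split=> H; apply: filterS2 fg H => x /= fgx.
    by rewrite in_itv/= => ex x01; rewrite -fgx// ex.
  by rewrite in_itv/= => ex x01; rewrite fgx// ex.
have -> : norm01 p (J f) = norm01 p (prim g).
  rewrite /norm01; congr Lnorm; apply/funext => x /=; congr EFin.
  by rewrite !patchE mem_setE in_itv/=; case: ifP => // /Jfg.
rewrite (norm01_powR hp (continuous_prim hm hM mg gmM) (prim0 g)).
have C0 : 0 < - (m * M) / (M - m).
  by rewrite divr_gt0 ?oppr_gt0 ?nmulr_rlt0// subr_gt0 (lt_trans hm).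
have [] := bounded_density_extremal hm hM hp mg gmM g1.
rewrite (extremal_value_powR hp C0).
set I := \int[leb R]_(x in _) _; set A := 1 / _ * _ => IA EA.
have I0 : 0 <= I by apply: Rintegral_ge0 => x _; exact: powR_ge0.
have A0 : 0 <= A by rewrite mulr_ge0 ?div1r ?invr_ge0 ?powR_ge0// ltW.
have AE : (A `^ p) `^ (1 / p) = A.
  by rewrite -powRrM div1r mulfV ?gt_eqF// powRr1.
have IE : (I `^ (1 / p)) `^ p = I.
  by rewrite -powRrM div1r mulVf ?gt_eqF// powRr1.
split.
  rewrite lee_fin -[leRHS]AE; apply: ge0_ler_powR => //.
  - by rewrite div1r invr_ge0 ltW.
  - by rewrite nnegrE powR_ge0.
rewrite !ae_fg -EA; split=> [[E]|->]; last by rewrite AE.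
by rewrite -E IE.
Qed.
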